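(* Let $p_0>0$. There is a constant $C\ge 1$, depending only on $p_0$, such that for every $p$ with $p_0\le p<\infty$ and every finite sequence $(X_n)_{n=1}^N$ of independent random variables with values in a Banach space, each two of the three quantities $$\|U\|_p,\qquad U^*(e^{-p}/4)+\|\ell\|_p,\qquad \bigl(U^{(\le \ell(e^{-p}/8))}\bigr)^*(e^{-p}/4)+\|\ell\|_p$$ are within a factor $C$ of each other; that is, $$\|U\|_p\approx U^*(e^{-p}/4)+\|\ell\|_p\approx \bigl(U^{(\le \ell(e^{-p}/8))}\bigr)^*(e^{-p}/4)+\|\ell\|_p$$ with constants of approximation depending only upon $p_0$.
   Context: $|\cdot|$ denotes the norm of the Banach space. For a random variable $X$ and $t\ge0$, $X^*(t)=\sup\{y\ge0:\Pr(|X|>y)>t\}$ (with $\sup\emptyset=0$), and $\|X\|_p=(\mathbb{E}|X|^p)^{1/p}\in[0,\infty]$. For a finite sequence $(X_n)_{n=1}^N$ of independent random variables, $U=\max_{1\le n\le N}\bigl|\sum_{k=1}^nX_k\bigr|$. For a real number $s$, $X_n^{(\le s)}=X_nI_{\{|X_n|\le s\}}$ and $U^{(\le s)}=\max_{1\le n\le N}\bigl|\sum_{k=1}^nX_k^{(\le s)}\bigr|$. For $t\ge0$, $\tilde\ell(t)\in[0,\infty]$ is the least number such that $\sum_n\Pr(|X_n|>\tilde\ell(t))\le t$; $\ell(t)=\tilde\ell(t)$ for $0\le t\le1$ and $\ell(t)=0$ for $t>1$. The function $\ell$ is regarded as a random variable on $[0,1]$ with Lebesgue measure, so $\|\ell\|_p=(\int_0^1\ell(t)^p\,dt)^{1/p}$.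 All quantities may take the value $+\infty$. $A\approx B$ means $c_1^{-1}A\le B\le c_2A$ for positive constants $c_1,c_2$ (the constants of approximation). *)

(* Defs.v *)
From HB Require Import structures.
From mathcomp Require Import all_boot all_order all_algebra.
From mathcomp Require Import all_classical all_reals all_analysis.

Set Implicit Arguments.
Unset Strict Implicit.
Unset Printing Implicit Defensive.

Import Order.TTheory GRing.Theory Num.Theory.
Import numFieldNormedType.Exports.

Local Open Scope classical_set_scope.
Local Open Scope ring_scope.

Section Definitions.
Context {R : realType} {d : measure_display} {T : measurableType d}.
Context {E : normedModType R}.
Implicit Types (P : probability T R) (t p : R).

Definition borel (B : set E) : Prop := <<s [set A : set E | open A] >> B.

(* Strong measurability. Separability of the range makes sums of random
   variables Borel measurable in a non-separable E; it is automatic when E is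
   separable. *)
Definition random_vector (X : T -> E) : Prop :=
  (forall B, borel B -> measurable (X @^-1` B)) /\
  (exists2 D : set E, countable D & range X `<=` closure D).

Definition independent P (N : nat) (X : 'I_N -> T -> E) : Prop :=
  forall B : 'I_N -> set E, (forall n, borel (B n)) ->
    P [set w | forall n, B n (X n w)] =
    (\big[*%E/1]_(n < N) P (X n @^-1` B n))%E.

(* max_{1 <= n <= N} |X_1 + ... + X_n|; the norms are nonnegative, so 0 is a
   neutral default value for the maximum. *)
Definition maxsum (N : nat) (X : 'I_N -> T -> E) (w : T) : R :=
  \big[Num.max/0]_(n < N) `|\sum_(k < N | (k <= n)%N) X k w|.

Definition trunc_le (s : \bar R) (X : T -> E) (w : T) : E :=
  if (`|X w|%:E <= s)%E then X w else 0.

(* The maximum with 0 implements the convention that the supremum of the empty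
   set is 0 (ereal_sup set0 is -oo). *)
Definition rearr P (Y : T -> R) t : \bar R :=
  Order.max 0%E
    (ereal_sup [set y%:E | y in [set y : R | 0 <= y /\
                  (t%:E < P [set w | (y < `|Y w|)%R])%E]]).

(* The infimum is attained, see [elltilde_least]. *)
Definition elltilde P (N : nat) (X : 'I_N -> T -> E) t : \bar R :=
  ereal_inf [set y : \bar R | (0 <= y)%E /\
    (\sum_(n < N) P [set w | (y < `|X n w|%:E)%E] <= t%:E)%E].

Definition ell P (N : nat) (X : 'I_N -> T -> E) t : \bar R :=
  if t <= 1 then elltilde P X t else 0%E.

Definition ell_norm P (N : nat) (X : 'I_N -> T -> E) p : \bar R :=
  ((\int[lebesgue_measure]_(t in `[0%R, 1%R]) (ell P X t `^ p)) `^ p^-1)%E.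

End Definitions.

Definition within_factor {R : realType} (C : R) (A B : \bar R) : Prop :=
  (A <= C%:E * B)%E /\ (B <= C%:E * A)%E.

Section elltilde_least.
Context {R : realType} {d : measure_display} {T : measurableType d}.
Context {E : normedModType R} (P : probability T R).
Variables (N : nat) (X : 'I_N -> T -> E).
Hypothesis mX : forall n, random_vector (X n).

Let tail (y : \bar R) : \bar R :=
  (\sum_(n < N) P [set w | (y < `|X n w|%:E)%E])%E.

Let measurable_tail n y : measurable [set w | (y < `|X n w|%:E)%E].
Proof.
have [mXn _] := mX n.
apply: (mXn [set x | (y < `|x|%:E)%E]); apply: sub_sigma_algebra => /=.
case: y => [r| |].
- have -> : [set x : E | (r%:E < `|x|%:E)%E] = Num.norm @^-1` [set s | r < s].
    by apply/seteqP; split => x /=; rewrite lte_fin.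
  apply: open_comp; last exact: open_gt.
  by move=> x _; exact: norm_continuous.
- rewrite [X in open X](_ : _ = set0); first exact: open0.
  by apply/seteqP; split => x.
- rewrite [X in open X](_ : _ = setT); first exact: openT.
  by apply/seteqP; split => x //= _; rewrite ltNyr.
Qed.

Lemma elltilde_least t : 0 <= t ->
  [/\ (0 <= elltilde P X t)%E, (tail (elltilde P X t) <= t%:E)%E &
      forall y, (0 <= y)%E -> (tail y <= t%:E)%E -> (elltilde P X t <= y)%E].
Proof.
move=> t0; set m := elltilde P X t.
have m0 : (0 <= m)%E by apply: le_ereal_inf_tmp => y [].
split => //; last by move=> y y0 yt; apply: ereal_inf_lbound.
have [my|mNy] := eqVneq m +oo%E.
  rewrite /tail big1 ?lee_fin// => n _.
  rewrite my [X in P X](_ : _ = set0) ?measure0//.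
  by apply/seteqP; split => w.
have mfin : m \is a fin_num by rewrite ge0_fin_numE// ltey.
pose F n k := [set w | (m + (k.+1%:R^-1)%:E < `|X n w|%:E)%E].
have tailF k : (\sum_(n < N) P (F n k) <= t%:E)%E.
  have k0 : 0 < k.+1%:R^-1 :> R by rewrite invr_gt0 ltr0n.
  have [y [y0 yt] ym] := lb_ereal_inf_adherent k0 mfin.
  apply: le_trans yt; apply: lee_sum => n _.
  apply: le_measure; rewrite ?inE; [exact: measurable_tail..|].
  by move=> w; apply: lt_trans.
have FE n : [set w | (m < `|X n w|%:E)%E] = \bigcup_k F n k.
  rewrite -(fineK mfin) /F -(fineK mfin); apply/seteqP; split => w /=.
    rewrite lte_fin => /[dup] mw; rewrite -subr_gt0 => h.
    exists (Num.truncn (`|X n w| - fine m)^-1) => //=.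
    rewrite -EFinD lte_fin -ltrBrDl.
    rewrite invf_plt ?posrE ?ltr0n//.
    exact: truncnS_gt.
  move=> [k _] /=; rewrite -EFinD !lte_fin; apply: le_lt_trans.
  by rewrite lerDl invr_ge0 ler0n.
have cF n : (P \o F n) @ \oo --> P [set w | (m < `|X n w|%:E)%E].
  rewrite FE; apply: nondecreasing_cvg_mu.
  - by move=> k; exact: measurable_tail.
  - by apply: bigcup_measurable => k _; exact: measurable_tail.
  - move=> a b ab; apply/subsetPset => w; apply: le_lt_trans.
    by rewrite leeD2l// lee_fin lef_pV2 ?posrE ?ltr0n// ler_nat.
have cS : (fun k => \sum_(n < N) P (F n k))%E @ \oo --> tail m.
  apply: cvg_nnesum => n _; last exact: cF.
  by near=> k; exact: measure_ge0.
by apply: (cvge_to_le cS); near=> k; exact: tailF.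
Unshelve. all: by end_near. Qed.

End elltilde_least.

(* Main.v *)
Require Import Defs.
From HB Require Import structures.
From mathcomp Require Import all_boot all_order all_algebra.
From mathcomp Require Import all_classical all_reals all_analysis.
From mathcomp Require Import measurable_realfun ring lra.
Import Order.TTheory GRing.Theory Num.Theory.
Import numFieldNormedType.Exports.
Local Open Scope classical_set_scope.
Local Open Scope ring_scope.

(* Write [S_n] for the partial sums and [tau(y)] for [sum_n P(|X_n| > y)].
   Stopping at the first [k] with [|S_k| > u] gives the Hoffmann-Jorgensen type
   inequality

     P(U > u + v + 2z) <= tau(v) + P(U > u) P(U > z).

   If [P(U > z) <= e^-p / 2] for all [z > q], then taking [u = x], [v = x / 2],
   [z = x / 4] yields [P(U > 2x) <= tau(x / 2) + (e^-p / 2) P(U > x)] for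
   [x > 4q].  Since [e > 2], integrating against [p x^(p-1) dx] lets the last
   term be absorbed, so that [E U^p <= 2 (8q)^p + 2 * 4^p * ||ell||_p^p]: the
   function [ell] has distribution function [min(1, tau)].  This bounds
   [||U||_p] both with [q = U^*(e^-p / 4)] and with the truncated quantity,
   because truncating at [ell(e^-p / 8)] changes [U] with probability at most
   [e^-p / 8].  The converse bounds are Chebyshev's inequality and
   [min(1, tau(y)) <= 2 P(max |X_n| > y)], which holds by independence. *)

(** * Tonelli and the layer-cake formula *)

Section layer_cake.
Context {R : realType} {d : measure_display} {T : measurableType d}.
Variables (mu : {sigma_finite_measure set T -> \bar R}) (f : T -> \bar R).
Hypothesis mf : measurable_fun [set: T] f.

Let hypograph : set (T * measurableTypeR R) := [set z | (z.2%:E < f z.1)%E].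

Let measurable_hypograph : measurable hypograph.
Proof.
have m2 : measurable_fun [set: T * measurableTypeR R] (EFin \o snd).
  by apply/measurable_EFinP; exact: measurable_snd.
have m1 : measurable_fun [set: T * measurableTypeR R] (f \o fst).
  exact: measurableT_comp.
have /(_ measurableT [set true]) := measurable_fun_lte m2 m1.
by rewrite setTI; exact.
Qed.

(** The tails are the measures of the horizontal sections of [hypograph], hence measurable in the
    level by sigma-finiteness. *)
Lemma measurable_tail :
  measurable_fun [set: R] (fun y : R => mu [set x | (y%:E < f x)%E]).
Proof.
have := measurable_fun_ysection mu measurable_hypograph.
apply: eq_measurable_fun => y _ /=; congr (mu _).
by apply/seteqP; split => x; rewrite /ysection/= inE.
Qed.

(** Tonelli for the indicator of the region [0 <= y < f x]: the vertical section at [x] is an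
    interval of length [f x], or a half-line when [f x] is infinite, and the horizontal section at
    [y] is a superlevel set. *)
Lemma layer_cake : (forall x, 0 <= f x)%E ->
  (\int[mu]_x f x =
   \int[lebesgue_measure]_(y in `[0%R, +oo[) mu [set x | (y%:E < f x)%E])%E.
Proof.
move=> f0.
pose A := hypograph `&` (setT `*` `[0%R, +oo[%classic).
have mA : measurable A by apply: measurableI => //; exact: measurableX.
have := @indic_fubini_tonelli _ _ T (measurableTypeR R) R mu
  (@lebesgue_measure R) A mA.
rewrite indic_fubini_tonelli_FE// indic_fubini_tonelli_GE// => fub.
transitivity (\int[mu]_x (lebesgue_measure \o xsection A) x)%E.
  apply: eq_integral => x _ /=.
  have -> : xsection A x = [set y | 0 <= y /\ (y%:E < f x)%E].
    apply/seteqP; split => y; rewrite /xsection/= inE /A /hypograph/= in_itv/= andbT.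
      by move=> [? []].
    by move=> [].
  case: (f x) (f0 x) => [r|_|//].
    rewrite lee_fin => r0.
    transitivity (lebesgue_measure `[0%R, r[%classic).
      by rewrite lebesgue_measure_itv/= lte_fin; case: ltgtP r0 => [_|//|<-//] _;
        rewrite oppr0 adde0.
    congr lebesgue_measure; apply/seteqP; split => y /=; rewrite in_itv/= lte_fin.
      by move/andP.
    by move=> [-> ->].
  transitivity (lebesgue_measure (`[0%R, +oo[%classic : set R)).
    by rewrite lebesgue_measure_itv/= ltry.
  congr lebesgue_measure; apply/seteqP; split => y /=; rewrite in_itv/= andbT ltry.
    by move=> ->.
  by move=> [->].
rewrite fub [RHS]integral_mkcond; apply: eq_integral => y _ /=.
rewrite patchE; case: ifPn => [|/negP yN].
  rewrite inE/= in_itv/= andbT => y0; congr (mu _).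
  apply/seteqP; split => x; rewrite /ysection/= inE /A /hypograph/= in_itv/= andbT.
    by move=> [].
  by [].
rewrite [X in mu X](_ : _ = set0) ?measure0//; apply/seteqP; split => x //.
by rewrite /ysection/= inE => -[_ [_ ?]]; apply: yN; rewrite inE.
Qed.

End layer_cake.

(** * Random vectors with separable range *)

Lemma countable_enum (S : pointedType) (D : set S) :
  countable D -> exists e : nat -> S, D `<=` range e.
Proof.
move=> /countable_injP[f finj].
(* Indices outside the image of [D] under [f] receive the default [point]; as [D] may be empty, only
   an inclusion in the range can be asked. *)
exists (fun n => xget point [set x | D x /\ f x = n]) => x Dx.
exists (f x) => //=.
have [Dy fy] : [set y | D y /\ f y = f x] (xget point [set y | D y /\ f y = f x]).
  by apply: (@xgetPex _ point [set y | D y /\ f y = f x]); exists x.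
by apply: finj => //; rewrite inE.
Qed.

Section random_vectors.
Context {R : realType} {d : measure_display} {T : measurableType d}.
Context {E : normedModType R}.
Implicit Types (X Y : T -> E).

Lemma closure_normP (D : set E) x :
  closure D x <-> forall e : R, 0 < e -> exists2 y, D y & `|x - y| < e.
Proof.
split=> [cx e e0|h B /nbhs_ballP[e /= e0 sB]].
  have [y [Dy]] := cx _ (nbhsx_ballx x e e0).
  by rewrite -ball_normE /= => ?; exists y.
have [y Dy xy] := h _ e0; exists y; split => //; apply: sB.
by rewrite -ball_normE.
Qed.

Lemma preimage_borel X :
  (forall B, open B -> measurable (X @^-1` B)) ->
  forall B, borel B -> measurable (X @^-1` B).
Proof.
move=> Xopen; suff : <<s [set A : set E | open A] >> `<=`
    [set B | measurable (X @^-1` B)] by [].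
apply: smallest_sub; last exact: Xopen.
split=> [|A mA|F mF]; first by rewrite /= preimage_set0; exact: measurable0.
- by rewrite /= setTD -preimage_setC; exact: measurableC.
- by rewrite /= preimage_bigcup; exact: bigcupT_measurable.
Qed.

Lemma random_vector_cst (x : E) : random_vector (fun _ : T => x).
Proof.
split=> [B _|]; last first.
  exists [set x]; first exact: countable1.
  by move=> _ [w _ <-]; exact: subset_closure.
rewrite preimage_cst; case: ifP => _; [exact: measurableT|exact: measurable0].
Qed.

(** When [E] is not separable, the Borel sets of [E * E] may exceed the product sigma-algebra, so
    continuity of addition does not suffice. Countable sets approximating both ranges let the
    preimage of an open set be written as a countable union of events of the form: [X] in a ball and
    [Y] in a ball. *)
Lemma random_vectorD X Y :
  random_vector X -> random_vector Y -> random_vector (fun w => X w + Y w).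
Proof.
move=> [mX [D cD XD]] [mY [D' cD' YD']]; split; last first.
  exists [set z.1 + z.2 | z in D `*` D'].
    by apply: (sub_countable (card_image_le _ _)); exact: countableX.
  move=> _ [w _ <-]; apply/closure_normP => e e0.
  have e20 : 0 < e / 2 by rewrite divr_gt0.
  have [x Dx xX] := (closure_normP _ _).1 (XD _ (imageT X w)) _ e20.
  have [y Dy yY] := (closure_normP _ _).1 (YD' _ (imageT Y w)) _ e20.
  exists (x + y); first by exists (x, y).
  rewrite opprD addrACA; apply: (le_lt_trans (ler_normD _ _)); lra.
have [e De] := countable_enum _ _ cD; have [f Df] := countable_enum _ _ cD'.
apply: preimage_borel => O oO.
(* Balls of radius [1/(m+1)] around [e i] and [f j] are kept only when the ball of twice that radius
   around [e i + f j] lies in [O], so that [X + Y] maps each [F z] into [O]. *)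
pose F (z : nat * nat * nat) := [set w |
  [/\ ball (e z.1.1) z.2.+1%:R^-1 (X w), ball (f z.1.2) z.2.+1%:R^-1 (Y w) &
      ball (e z.1.1 + f z.1.2) (z.2.+1%:R^-1 + z.2.+1%:R^-1) `<=` O]].
rewrite (_ : _ @^-1` _ = \bigcup_z F z).
  apply: countable_bigcupT_measurable => [|[[i j] m]]; [exact: countableP|]; rewrite /F/=.
  have [sub|nsub] := pselect (ball (e i + f j) (m.+1%:R^-1 + m.+1%:R^-1) `<=` O).
    rewrite (_ : mkset _ = X @^-1` ball (e i) m.+1%:R^-1 `&`
                           Y @^-1` ball (f j) m.+1%:R^-1).
      by apply: measurableI; [apply: mX|apply: mY];
        apply: sub_sigma_algebra; exact: ball_open.
    by apply/seteqP; split => w /= => [[]|[]].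
  rewrite (_ : mkset _ = set0); first exact: measurable0.
  by apply/seteqP; split => w // -[].
apply/seteqP; split => w /=; last first.
  move=> [[[i j] m] _ [/= wi wj]]; apply.
  move: wi wj; rewrite -!ball_normE/= => wi wj.
  by rewrite opprD addrACA; apply: (le_lt_trans (ler_normD _ _)); rewrite ltrD.
move=> Ow; have /nbhs_ballP[r /= r0 rO] : nbhs (X w + Y w) O by exact: open_nbhs_nbhs.
(* Approximating [X w] and [Y w] costs [1/(m+1)] each, and the ball around [e i + f j] has radius
   [2/(m+1)]; the total [4/(m+1)] must stay below [r]. *)
pose m := Num.truncn (4 / r).
have m0 : 0 < m.+1%:R^-1 :> R by rewrite invr_gt0 ltr0n.
have mr : 4 * m.+1%:R^-1 < r.
  by rewrite ltr_pdivrMr ?ltr0n// mulrC -ltr_pdivrMr//; exact: truncnS_gt.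
have [x /De[i _ <-] xX] := (closure_normP _ _).1 (XD _ (imageT X w)) _ m0.
have [y /Df[j _ <-] yY] := (closure_normP _ _).1 (YD' _ (imageT Y w)) _ m0.
exists (i, j, m) => //; split => /=; rewrite -ball_normE/=; [by rewrite distrC..|].
move=> z /= zij; apply: rO; rewrite -ball_normE/=.
have -> : X w + Y w - z = (X w - e i) + (Y w - f j) + (e i + f j - z).
  by rewrite [X w - e i + _]addrACA -opprD addrA subrK.
apply: (le_lt_trans (ler_normD _ _)).
apply: (le_lt_trans (lerD (ler_normD _ _) (lexx _))).
by move: mr zij xX yY; move: (m.+1%:R^-1 : R) => a; lra.
Qed.

Lemma random_vector_sum (I : Type) (r : seq I) (J : pred I) (X : I -> T -> E) :
  (forall i, J i -> random_vector (X i)) ->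
  random_vector (fun w => \sum_(i <- r | J i) X i w).
Proof.
move=> mX; elim: r => [|i r IH].
  rewrite (_ : (fun _ => _) = fun=> 0); first exact: random_vector_cst.
  by apply/funext => w; rewrite big_nil.
have [Ji|/negbTE NJi] := boolP (J i).
  rewrite (_ : (fun _ => _) = fun w => X i w + \sum_(j <- r | J j) X j w).
    by apply: random_vectorD => //; exact: mX.
  by apply/funext => w; rewrite big_cons Ji.
rewrite (_ : (fun _ => _) = fun w => \sum_(j <- r | J j) X j w) //.
by apply/funext => w; rewrite big_cons NJi.
Qed.

Lemma measurable_normr_gt X (y : \bar R) : random_vector X ->
  measurable [set w | (y < `|X w|%:E)%E].
Proof.
move=> [mX _]; apply: (mX [set x | (y < `|x|%:E)%E]); apply: sub_sigma_algebra => /=.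
case: y => [r| |].
- rewrite (_ : mkset _ = Num.norm @^-1` [set s | r < s]); last first.
    by apply/seteqP; split => x /=; rewrite lte_fin.
  by apply: open_comp; [move=> x _; exact: norm_continuous|exact: open_gt].
- rewrite (_ : mkset _ = set0); first exact: open0.
  by apply/seteqP; split => x.
- rewrite (_ : mkset _ = setT); first exact: openT.
  by apply/seteqP; split => x //= _; rewrite ltNyr.
Qed.

Lemma random_vector_trunc_le (s : \bar R) X :
  random_vector X -> random_vector (trunc_le s X).
Proof.
move=> /[dup] rX [mX [D cD XD]]; split=> [B mB|].
  have mgt := measurable_normr_gt X s rX.
  rewrite (_ : _ @^-1` _ = X @^-1` B `&` ~` [set w | (s < `|X w|%:E)%E] `|`
     (fun=> 0) @^-1` B `&` [set w | (s < `|X w|%:E)%E]).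
    apply: measurableU; apply: measurableI => //; [exact: mX|exact: measurableC|].
    by have [mc _] := random_vector_cst 0; exact: mc.
  apply/seteqP; split => w; rewrite /trunc_le/= leNgt.
    by case: ltP => // h Bw; [right|left; split => //; apply/negP; rewrite -leNgt].
  by move=> [[Bw /negP/negbTE ->]|[B0 ->]].
exists (D `|` [set 0]).
  rewrite -bigcup2E; apply: bigcup_countable => [|[|[|k]] _ //=].
  exact: countableP.
move=> _ [w _ <-]; rewrite closureU /trunc_le; case: ifP => _.
  by left; apply: XD; exists w.
by right; exact: subset_closure.
Qed.

End random_vectors.

(** * Independence passed from pi-systems to sigma-algebras *)

Section independent_sigma_algebras.
Context {R : realType} {d : measure_display} {T : measurableType d}.
Variable P : probability T R.

(** Dynkin's pi-lambda argument: the measurable sets independent of the fixed [B] form a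
    lambda-system containing the pi-system [G]. *)
Lemma indep_sigma_algebra (G : set (set T)) (B : set T) :
  setI_closed G -> G `<=` measurable -> measurable B ->
  (forall A, G A -> P (A `&` B) = (P A * P B)%E) ->
  forall A, <<s G >> A -> P (A `&` B) = (P A * P B)%E.
Proof.
move=> GI Gm mB GB.
suff : <<s G >> `<=` [set A | measurable A /\ P (A `&` B) = (P A * P B)%E].
  by move=> h A /h[].
apply: lambda_system_subset => //; last by move=> A GA; split; [exact: Gm|exact: GB].
apply/dynkin_lambda_system; split => /=.
- by split; [exact: measurableT|rewrite setTI probability_setT mul1e].
- move=> A [mA AB]; split; first exact: measurableC.
  rewrite setIC -setDE measureD//; last by rewrite ltey_eq fin_num_measure.
  rewrite probability_setC// muleBl ?mul1e ?fin_num_adde_defr ?fin_num_measure//.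
  by rewrite -AB setIC.
- move=> F tF FB; have mF k : measurable (F k) by have [] := FB k.
  split; first exact: bigcupT_measurable.
  rewrite setI_bigcupl !measure_bigcup//; last 2 first.
  + by move=> k _; exact: measurableI.
  + exact: trivIset_setIr.
  rewrite [RHS]muleC -(fineK (fin_num_measure P B mB)) -nneseriesZl//.
  apply: eq_eseriesr => k _.
  by rewrite (fineK (fin_num_measure P B mB)) [RHS]muleC; exact: (FB k).2.
Qed.

(** [indep_sigma_algebra] is applied twice, enlarging one factor while the other is held fixed. *)
Lemma indep_sigma_algebras (G H : set (set T)) :
  setI_closed G -> setI_closed H -> G `<=` measurable -> H `<=` measurable ->
  (forall A B, G A -> H B -> P (A `&` B) = (P A * P B)%E) ->
  forall A B, <<s G >> A -> <<s H >> B -> P (A `&` B) = (P A * P B)%E.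
Proof.
move=> GI HI Gm Hm GH A B GA HB.
have mA : measurable A.
  by apply: (smallest_sub _ Gm) GA; exact: sigma_algebra_measurable.
rewrite setIC muleC; apply: (indep_sigma_algebra H) => // B' HB'.
rewrite setIC muleC; apply: (indep_sigma_algebra G) => //; first exact: Hm.
by move=> A' GA'; exact: GH.
Qed.

End independent_sigma_algebras.

(** * Sigma-algebras generated by subfamilies of the variables *)

Section cylinders.
Context {R : realType} {d : measure_display} {T : measurableType d}.
Context {E : normedModType R} (P : probability T R).
Context {N : nat} (X : 'I_N -> T -> E).

Lemma borelT : borel (setT : set E).
Proof. by apply: sub_sigma_algebra; exact: openT. Qed.

Lemma borelI (A B : set E) : borel A -> borel B -> borel (A `&` B).
Proof. exact: (@measurableI _ (g_sigma_algebraType [set A : set E | open A])). Qed.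

Definition cylinder (J : pred 'I_N) (B : 'I_N -> set E) : set T :=
  [set w | forall n, J n -> B n (X n w)].

(** A pi-system generating the sigma-algebra of the [X n] with [n] in [J]. *)
Definition cylinders (J : pred 'I_N) : set (set T) :=
  [set A | exists2 B, (forall n, borel (B n)) & A = cylinder J B].

Lemma setI_closed_cylinders J : setI_closed (cylinders J).
Proof.
move=> _ _ [A bA ->] [B bB ->]; exists (fun n => A n `&` B n).
  by move=> n; exact: borelI.
apply/seteqP; split => w /=; first by move=> [Aw Bw] n Jn; split; [exact: Aw|exact: Bw].
by move=> ABw; split => n /ABw[].
Qed.

(** Once [T] carries the sigma-algebra generated by [cylinders J], the general measurability lemmas
    show that an event depends only on the variables indexed by [J]. *)
Lemma random_vector_cylinders (J : pred 'I_N) n : J n -> random_vector (X n) ->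
  @random_vector R _ (g_sigma_algebraType (cylinders J)) E (X n).
Proof.
move=> Jn [_ sepX]; split => // B bB; apply: sub_sigma_algebra.
exists (fun m => if m == n then B else setT).
  by move=> m; case: eqP => // _; exact: borelT.
apply/seteqP; split => w /=; last by move=> /(_ n Jn); rewrite eqxx.
by move=> Bw m Jm; case: eqP => // ->.
Qed.

Hypotheses (mX : forall n, random_vector (X n)) (indX : independent P X).

Lemma cylinders_measurable J : cylinders J `<=` measurable.
Proof.
move=> _ [B bB ->].
rewrite (_ : cylinder J B = \bigcap_(n in [set n | J n]) X n @^-1` B n)//.
apply: fin_bigcap_measurable => [|n _]; first exact: finite_finset.
by have [mXn _] := mX n; exact: mXn.
Qed.

Lemma prob_cylinder J B : (forall n, borel (B n)) ->
  P (cylinder J B) = (\big[*%E/1]_(n < N | J n) P (X n @^-1` B n))%E.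
Proof.
(* [independent] constrains all indices at once, so those outside [J] get the whole space, which has
   preimage of probability 1. *)
move=> bB; pose B' n := if J n then B n else setT.
have -> : cylinder J B = [set w | forall n, B' n (X n w)].
  apply/seteqP; split => w /= h n; last by move=> Jn; move: (h n); rewrite /B' Jn.
  by rewrite /B'; case: ifP => // /h.
rewrite indX; last by move=> n; rewrite /B'; case: ifP => // _; exact: borelT.
rewrite [RHS]big_mkcond/=; apply: eq_bigr => n _; rewrite /B'.
by case: ifP => // _; rewrite preimage_setT probability_setT.
Qed.

(** As [J] and [K] are disjoint, a cylinder over [J] and one over [K] intersect in a cylinder over
    the union, whose probability factors; the pi-system lemma does the rest. *)
Lemma indep_cylinders (J K : pred 'I_N) A B : (forall n, J n -> ~~ K n) ->
  <<s cylinders J >> A -> <<s cylinders K >> B -> P (A `&` B) = (P A * P B)%E.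
Proof.
move=> JK; apply: indep_sigma_algebras; try exact: setI_closed_cylinders;
  try exact: cylinders_measurable.
move=> _ _ [B1 bB1 ->] [B2 bB2 ->].
pose B' n := if J n then B1 n else B2 n.
have -> : cylinder J B1 `&` cylinder K B2 = cylinder (fun n => J n || K n) B'.
  apply/seteqP; split => w /=.
    move=> [h1 h2] n; rewrite /B'; case: ifPn => [Jn _|_ /=]; [exact: h1|exact: h2].
  move=> h; split => n Jn; move: (h n); rewrite /B'.
    by rewrite Jn; exact.
  by have := JK n; case: (J n) => [/(_ isT)|_]; rewrite Jn// => /(_ isT).
rewrite !prob_cylinder//; last by move=> n; rewrite /B'; case: ifP.
rewrite (bigID J)/=.
congr (_ * _)%E; apply: eq_big => n.
- by case: (J n); rewrite ?andbF.
- by rewrite /B' => /andP[_ ->].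
- by have := JK n; case: (J n) => [/(_ isT)/negbTE ->|_]; rewrite ?andbF ?andbT.
- by rewrite /B' => /andP[_ /negbTE ->].
Qed.

End cylinders.

(** * Finite unions and maxima of partial sums *)

Section finite_unions.
Context {R : realType} {d : measure_display} {T : measurableType d}.

Lemma bigsetU_finP (I : finType) (F : I -> set T) w :
  (\big[setU/set0]_i F i) w <-> exists i, F i w.
Proof.
rewrite -bigcup_seq; split=> [[i _ Fw]|[i Fw]]; first by exists i.
by exists i => //=; rewrite mem_index_enum.
Qed.

Lemma measure_bigsetU_le (mu : {measure set T -> \bar R}) (I : finType)
    (F : I -> set T) : (forall i, measurable (F i)) ->
  (mu (\big[setU/set0]_i F i) <= \sum_i mu (F i))%E.
Proof.
move=> mF; elim: (index_enum I) => [|i r IH]; first by rewrite !big_nil measure0.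
rewrite !big_cons (le_trans (measureU2 _ _ _))//; last exact: leeD2l.
exact: bigsetU_measurable.
Qed.

End finite_unions.

Section maxsum_theory.
Context {R : realType} {d : measure_display} {T : measurableType d}.
Context {E : normedModType R} {N : nat} (X : 'I_N -> T -> E).
Implicit Types (w : T).

(** The sign condition excludes the default value 0 of the maximum: for [N = 0] it exceeds every
    negative [y] although there is no index. *)
Lemma maxsum_gtP w (y : R) : 0 <= y ->
  (y < maxsum X w) <->
  exists n : 'I_N, y < `|\sum_(k < N | (k <= n)%N) X k w|.
Proof.
move=> y0; split=> [|[n yn]]; last first.
  by apply: (lt_le_trans yn); exact: (le_bigmax (0 : R) (fun n : 'I_N =>
    `|\sum_(k < N | (k <= n)%N) X k w|)).
apply: contraPP => /forallNP h; apply/negP; rewrite -leNgt.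
by apply/bigmax_leP; split => // n _; rewrite leNgt; apply/negP.
Qed.

Lemma maxsum_ge0 w : 0 <= maxsum X w.
Proof. exact: bigmax_ge_id. Qed.

Lemma norm_sum_le_maxsum w (n : 'I_N) :
  `|\sum_(k < N | (k <= n)%N) X k w| <= maxsum X w.
Proof.
exact: (le_bigmax (0 : R) (fun n : 'I_N => `|\sum_(k < N | (k <= n)%N) X k w|)).
Qed.

Lemma sum_prefixB w (k n : 'I_N) : (k <= n)%N ->
  \sum_(j < N | (j <= n)%N) X j w - \sum_(j < N | (j <= k)%N) X j w =
  \sum_(j < N | (k < j <= n)%N) X j w.
Proof.
move=> kn; rewrite (bigID (fun j : 'I_N => (j <= k)%N))/=.
have -> : \sum_(j < N | (j <= n)%N && (j <= k)%N) X j w =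
          \sum_(j < N | (j <= k)%N) X j w.
  apply: eq_bigl => j; case: (leqP j k) => [jk|]; rewrite ?andbF ?andbT//.
  exact: leq_trans kn.
rewrite addrAC subrr add0r; apply: eq_bigl => j.
by rewrite -ltnNge andbC.
Qed.

Lemma sum_prefixE w (k : 'I_N) :
  \sum_(j < N | (j <= k)%N) X j w = \sum_(j < N | (j < k)%N) X j w + X k w.
Proof.
rewrite (bigD1 k)//= addrC; congr (_ + _); apply: eq_bigl => j.
by rewrite ltn_neqAle andbC.
Qed.

(** The sum over [i < k] is either empty or the partial sum at [k - 1]; this handles the sum just
    before [k] without a separate case [k = 0]. *)
Lemma sum_prefix_lt_ind (Q : E -> Prop) w (k : 'I_N) : Q 0 ->
  (forall j : 'I_N, (j < k)%N -> Q (\sum_(i < N | (i <= j)%N) X i w)) ->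
  Q (\sum_(i < N | (i < k)%N) X i w).
Proof.
move=> Q0 Qj; case: (posnP k) => k0; first by rewrite k0 big1.
have m1 : (k.-1 < N)%N by rewrite (leq_ltn_trans (leq_pred k)).
rewrite (eq_bigl (fun i : 'I_N => (i <= Ordinal m1)%N)).
  by apply: Qj; rewrite /= ltn_predL.
by move=> i /=; rewrite -[in RHS]ltnS prednK.
Qed.

Lemma norm_le_maxsum w (n : 'I_N) : `|X n w| <= 2 * maxsum X w.
Proof.
have U0 := maxsum_ge0 w.
have -> : X n w = \sum_(k < N | (k <= n)%N) X k w - \sum_(k < N | (k < n)%N) X k w.
  by rewrite sum_prefixE addrAC subrr add0r.
have : `|\sum_(k < N | (k < n)%N) X k w| <= maxsum X w.
  apply: (sum_prefix_lt_ind (fun x => `|x| <= maxsum X w)); first by rewrite normr0.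
  by move=> j _; exact: norm_sum_le_maxsum.
have := norm_sum_le_maxsum w n.
have := ler_normB (\sum_(k < N | (k <= n)%N) X k w) (\sum_(k < N | (k < n)%N) X k w).
lra.
Qed.

Hypothesis mX : forall n, random_vector (X n).

Lemma measurable_norm_sum_gt (J : pred 'I_N) (y : R) :
  measurable [set w | y < `|\sum_(k < N | J k) X k w|].
Proof.
have := measurable_normr_gt (fun w => \sum_(k < N | J k) X k w) y%:E.
rewrite (_ : [set w | (y%:E < _)%E] = [set w | y < `|\sum_(k < N | J k) X k w|]).
  by apply; apply: random_vector_sum => k _; exact: mX.
by apply/seteqP; split => w /=; rewrite lte_fin.
Qed.

Lemma measurable_maxsum_gt (y : R) : measurable [set w | y < maxsum X w].
Proof.
have [y0|y0] := leP 0 y; last first.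
  rewrite (_ : mkset _ = setT); first exact: measurableT.
  by apply/seteqP; split => w //= _; rewrite (lt_le_trans y0)// maxsum_ge0.
rewrite (_ : mkset _ = \big[setU/set0]_(n < N)
   [set w | y < `|\sum_(k < N | (k <= n)%N) X k w|]).
  by apply: bigsetU_measurable => n _; exact: measurable_norm_sum_gt.
apply/seteqP; split => w /=.
  by move=> /(maxsum_gtP _ _ y0) h; apply/bigsetU_finP.
by move=> /bigsetU_finP h; apply/(maxsum_gtP _ _ y0).
Qed.

Lemma measurable_maxsum : measurable_fun [set: T] (maxsum X).
Proof.
apply: (measurability _ (RGenOInfty.measurableE R)) => //.
move=> _ [_ [y ->] <-]; rewrite setTI preimage_itvoy.
exact: measurable_maxsum_gt.
Qed.

End maxsum_theory.

(** * The Hoffmann-Jorgensen inequality *)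

Section hoffmann_jorgensen.
Context {R : realType} {d : measure_display} {T : measurableType d}.
Context {E : normedModType R} (P : probability T R).
Context {N : nat} (X : 'I_N -> T -> E).
Hypotheses (mX : forall n, random_vector (X n)) (indX : independent P X).

Let S (n : 'I_N) (w : T) := \sum_(k < N | (k <= n)%N) X k w.

(** The event that the first-passage time above [u] equals [k]; distinct [k] give disjoint
    events. *)
Let exit_at (u : R) (k : 'I_N) :=
  [set w | u < `|S k w| /\ forall j : 'I_N, (j < k)%N -> `|S j w| <= u].

Let late (z : R) (k : 'I_N) :=
  [set w | exists n : 'I_N, (k < n)%N /\ z < `|\sum_(j < N | (k < j <= n)%N) X j w|].

(** This and [late_future] place the two events in the sigma-algebras of disjoint blocks of
    variables, so that [indep_cylinders] applies. *)
Let exit_at_past u (k : 'I_N) : <<s cylinders X (fun j : 'I_N => (j <= k)%N) >> (exit_at u k).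
Proof.
pose Tk := g_sigma_algebraType (cylinders X (fun j : 'I_N => (j <= k)%N)).
have mS (j : 'I_N) : (j <= k)%N -> @measurable _ Tk [set w | u < `|S j w|].
  move=> jk.
  have -> : [set w | u < `|S j w|] = [set w | (u%:E < `|S j w|%:E)%E].
    by apply/seteqP; split => w /=; rewrite lte_fin.
  apply: (@measurable_normr_gt _ _ Tk); apply: random_vector_sum => i ij.
  by apply: random_vector_cylinders => //; exact: leq_trans jk.
rewrite (_ : exit_at u k = [set w | u < `|S k w|] `&`
    \bigcap_(j in [set j : 'I_N | (j < k)%N]) ~` [set w | u < `|S j w|]).
  apply: (@measurableI _ Tk); first exact: mS.
  apply: (@fin_bigcap_measurable _ Tk) => [|j /ltnW jk]; first exact: finite_finset.
  by apply: (@measurableC _ Tk); exact: mS.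
apply/seteqP; split => w /= [uk h]; split => // j jk.
  by apply/negP; rewrite -leNgt; exact: h.
by rewrite leNgt; apply/negP; exact: h.
Qed.

Let late_future z (k : 'I_N) : <<s cylinders X (fun j : 'I_N => (k < j)%N) >> (late z k).
Proof.
pose Tk := g_sigma_algebraType (cylinders X (fun j : 'I_N => (k < j)%N)).
rewrite (_ : late z k = \bigcup_(n in [set n : 'I_N | (k < n)%N])
    [set w | (z%:E < `|\sum_(j < N | (k < j <= n)%N) X j w|%:E)%E]); last first.
  apply/seteqP; split => w /=.
    by move=> [n [kn h]]; exists n.
  by move=> [n kn h]; exists n.
apply: (@fin_bigcup_measurable _ Tk) => [|n kn]; first exact: finite_finset.
apply: (@measurable_normr_gt _ _ Tk); apply: random_vector_sum => i /andP[ki _].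
exact: random_vector_cylinders.
Qed.

Let sub_measurable J A : <<s cylinders X J >> A -> measurable A.
Proof.
apply: smallest_sub; first exact: sigma_algebra_measurable.
exact: cylinders_measurable.
Qed.

(** If no [|X n|] exceeds [v], the sum at the first passage time [k] above [u] is at most [u + v],
    so some block sum starting after [k] exceeds [2 * z]. That event is independent of the passage
    at [k] and forces [z < maxsum X]; summing over [k] gives the product. *)
Lemma hoffmann_jorgensen (u v z : R) : 0 <= u -> 0 <= v -> 0 <= z ->
  (P [set w | (u + v + 2 * z < maxsum X w)%R] <=
   \sum_(n < N) P [set w | v%:E < `|X n w|%:E] +
   P [set w | (u < maxsum X w)%R] * P [set w | (z < maxsum X w)%R])%E.
Proof.
move=> u0 v0 z0.
have mbig n : measurable [set w | (v%:E < `|X n w|%:E)%E].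
  exact: measurable_normr_gt.
have mexit k : measurable (exit_at u k) by exact: sub_measurable (exit_at_past u k).
have mlate k : measurable (late (2 * z) k) by exact: sub_measurable (late_future _ k).
have mU := measurable_maxsum_gt X mX.
pose B := \big[setU/set0]_(n < N) [set w | (v%:E < `|X n w|%:E)%E].
pose C := \big[setU/set0]_(k < N) (exit_at u k `&` late (2 * z) k).
have mB : measurable B by exact: bigsetU_measurable.
have mC : measurable C by apply: bigsetU_measurable => k _; exact: measurableI.
apply: (@le_trans _ _ (P (B `|` C))).
  apply: le_measure; rewrite ?inE//; first exact: measurableU.
  move=> w /= Uw.
  have [Bw|Bw] := pselect (B w); [by left|right].
  have Xv n : `|X n w| <= v.
    rewrite leNgt; apply/negP => vX; apply: Bw; apply/bigsetU_finP.
    by exists n; rewrite /= lte_fin.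
  have [m um] : exists m : 'I_N, u < `|S m w|.
    apply/(maxsum_gtP X w u u0); apply: le_lt_trans Uw; lra.
  pose Q i := u < `|S i w|.
  case: (@arg_minnP _ m Q (@nat_of_ord N) um) => k uk kmin.
  (* Before the passage the sums are at most [u], and the passing jump is at most [v]. *)
  have Suk : `|S k w| <= u + v.
    rewrite /S sum_prefixE; apply: (le_trans (ler_normD _ _)); apply: lerD => //.
    apply: (sum_prefix_lt_ind X (fun x => `|x| <= u)); first by rewrite normr0.
    by move=> j jk; rewrite leNgt; apply/negP => /kmin; rewrite leqNgt jk.
  have yz : 0 <= u + v + 2 * z by lra.
  have [n un] := (maxsum_gtP X w _ yz).1 Uw.
  have kn : (k < n)%N.
    rewrite ltn_neqAle kmin; last by rewrite /Q; apply: le_lt_trans un; lra.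
    rewrite andbT; apply/negP => /eqP /val_inj kn.
    by move: un; rewrite -kn -/(S k w); lra.
  apply/bigsetU_finP; exists k; split.
    split => // j jk; rewrite leNgt; apply/negP => /kmin.
    by rewrite leqNgt jk.
  exists n; split => //; rewrite -sum_prefixB; last exact: ltnW.
  have := lerB_dist (S n w) (S k w).
  by move: un Suk; rewrite -/(S k w) -/(S n w); lra.
apply: (le_trans (measureU2 _ mB mC)); apply: leeD.
  exact: measure_bigsetU_le.
apply: (le_trans (measure_bigsetU_le _ _ _ _)) => [k|]; first exact: measurableI.
(* A block sum is a difference of two partial sums, so one of these exceeds [z] if the block exceeds
   [2 * z]. *)
have Plate k : (P (late (2 * z) k) <= P [set w | (z < maxsum X w)%R])%E.
  apply: le_measure; rewrite ?inE//.
  move=> w /= [n [kn]]; rewrite -sum_prefixB; last exact: ltnW.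
  move=> zS; have {}zS := lt_le_trans zS (ler_normB _ _).
  by have := norm_sum_le_maxsum X w n; have := norm_sum_le_maxsum X w k; lra.
apply: (@le_trans _ _ (\sum_(k < N) P (exit_at u k) * P [set w | (z < maxsum X w)%R])%E).
  apply: lee_sum => k _.
  rewrite [leLHS](_ : _ = P (exit_at u k) * P (late (2 * z) k))%E; last first.
    apply: (indep_cylinders P X mX indX _ _ _ _ _ (exit_at_past u k)
      (late_future (2 * z) k)).
    by move=> j; rewrite -leqNgt.
  exact: lee_wpmul2l.
rewrite -ge0_sume_distrl//; apply: lee_wpmul2r => //.
(* The passage events are disjoint and contained in [u < maxsum X]. *)
rewrite -measure_semi_additive_ord//.
- apply: le_measure; rewrite ?inE//; first exact: bigsetU_measurable.
  move=> w /bigsetU_finP[k [uk _]] /=.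
  by apply/(maxsum_gtP X w u u0); exists k.
- move=> i j _ _ [w [[ui hi] [uj hj]]]; apply: val_inj.
  case: (ltngtP i j) => // ij.
    by move: (hj _ ij); rewrite leNgt ui.
  by move: (hi _ ij); rewrite leNgt uj.
- exact: bigsetU_measurable.
Qed.

End hoffmann_jorgensen.

(** * The distribution function of [ell] *)

Lemma lt_poweR_root (R : realType) (p y : R) (x : \bar R) :
  0 < p -> 0 <= y -> (0 <= x)%E ->
  (y%:E < x `^ p)%E = ((y `^ p^-1)%:E < x)%E.
Proof.
move=> p0 y0; have pN0 : p != 0 by rewrite gt_eqF.
case: x => [x|_|//]; last by rewrite poweRyr// !ltry.
rewrite lee_fin => x0; rewrite poweR_EFin !lte_fin.
have yE : y = (y `^ p^-1) `^ p by rewrite -powRrM mulVf// powRr1.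
rewrite {1}yE; apply/idP/idP; last first.
  by apply: gt0_ltr_powR => //; rewrite nnegrE ?powR_ge0.
apply: contraTT; rewrite -!leNgt.
by apply: ge0_ler_powR; rewrite ?nnegrE ?powR_ge0// ltW.
Qed.

Section ell_distribution.
Context {R : realType} {d : measure_display} {T : measurableType d}.
Context {E : normedModType R} (P : probability T R).
Context {N : nat} (X : 'I_N -> T -> E).

(** The [tau(y)] of the overview. *)
Definition tail_sum (y : R) : \bar R :=
  (\sum_(n < N) P [set w | (y%:E < `|X n w|%:E)%E])%E.

Hypothesis mX : forall n, random_vector (X n).

Lemma tail_sum_fin_num y : tail_sum y \is a fin_num.
Proof.
apply/sum_fin_numP => n _ _; rewrite fin_num_measure//.
exact: measurable_normr_gt.
Qed.

Lemma tail_sum_ge0 y : (0 <= tail_sum y)%E.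
Proof. by apply: sume_ge0 => n _; exact: measure_ge0. Qed.

Lemma ell_ge0 t : 0 <= t -> (0 <= ell P X t)%E.
Proof.
by move=> t0; rewrite /ell; case: ifP => // _; have [] := elltilde_least P mX t0.
Qed.

(** [ell] is the generalized inverse of [tail_sum]. One direction is minimality of [elltilde]; the
    other is attainment of its infimum together with monotonicity of the tails. *)
Lemma ell_gt t y : 0 <= t <= 1 -> 0 <= y ->
  (y%:E < ell P X t)%E = (t%:E < tail_sum y)%E.
Proof.
move=> /andP[t0 t1] y0; rewrite /ell t1.
have [m0 mt mleast] := elltilde_least P mX t0.
apply/idP/idP; apply: contraTT; rewrite -!leNgt => h.
  by apply: mleast => //; rewrite lee_fin.
apply: le_trans mt; apply: lee_sum => n _; apply: le_measure;
  rewrite ?inE; [exact: measurable_normr_gt..|].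
by move=> w /=; exact: le_lt_trans.
Qed.

Lemma ell_superlevel y : 0 <= y ->
  `[0%R, 1%R] `&` [set t | (y%:E < ell P X t)%E] =
  `[0%R, 1%R] `&` `]-oo, fine (tail_sum y)[%classic.
Proof.
move=> y0; apply/seteqP; split => t /= [].
  rewrite !in_itv/= => t01; rewrite ell_gt// -(fineK (tail_sum_fin_num y)) lte_fin.
  by split.
rewrite !in_itv/= => t01 ty; split => //.
by rewrite ell_gt// -(fineK (tail_sum_fin_num y)) lte_fin.
Qed.

Lemma measurable_ell : measurable_fun (`[0%R, 1%R]%classic : set R) (ell P X).
Proof.
apply: (measurability _ (ErealGenOInfty.measurableE R)) => //.
move=> _ [_ [y ->] <-]; rewrite preimage_itvoy.
have [y0|y0] := leP 0 y.
  by rewrite ell_superlevel//; exact: measurableI.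
rewrite (_ : _ `&` _ = `[0%R, 1%R]%classic)//.
apply/seteqP; split => t /= => [[]//|t01]; split => //.
apply: (@lt_le_trans _ _ 0%E); first by rewrite lte_fin.
by apply: ell_ge0; move: t01; rewrite in_itv/= => /andP[].
Qed.

Lemma lebesgue_measure_ell_gt y : 0 <= y ->
  lebesgue_measure (`[0%R, 1%R] `&` [set t | (y%:E < ell P X t)%E]) =
  Order.min 1%E (tail_sum y).
Proof.
move=> y0; rewrite ell_superlevel//.
have : (0 <= tail_sum y)%E by exact: tail_sum_ge0.
rewrite -(fineK (tail_sum_fin_num y)); move: (fine _) => a; rewrite lee_fin => a0.
have [a1|a1] := leP a 1.
  rewrite (_ : _ `&` _ = `[0%R, a[%classic).
    rewrite lebesgue_measure_itv/= lte_fin min_r ?lee_fin//.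
    by case: ltgtP a0 => [_|//|<-//] _; rewrite oppr0 adde0.
  apply/seteqP; split => t /=; rewrite !in_itv/=.
    by move=> [/andP[-> _] ->].
  by move=> /andP[-> ta]; rewrite ta (ltW (lt_le_trans ta _)).
rewrite (_ : _ `&` _ = `[0%R, 1%R]%classic).
  by rewrite lebesgue_measure_itv/= lte_fin ltr01 oppr0 adde0 min_l// lee_fin ltW.
apply/seteqP; split => t /=; rewrite !in_itv/=; first by move=> [].
by move=> /andP[-> t1]; rewrite t1 (le_lt_trans t1).
Qed.

Lemma measurable_poweR_ell p :
  measurable_fun (`[0%R, 1%R]%classic : set R) (fun t => ell P X t `^ p)%E.
Proof.
exact: (measurableT_comp (measurable_poweR p) measurable_ell).
Qed.

(** The [p]-th power of [c * ell], extended by 0 to the whole line because [layer_cake] integrates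
    over a full type. The scale [c] is 1 in the lower bound for the moment of [maxsum X] and 2 in
    the upper bound. *)
Definition ell_power (c p : R) : R -> \bar R :=
  (fun t => (c `^ p)%:E * ell P X t `^ p)%E \_ `[0%R, 1%R].

Lemma measurable_ell_power c p : measurable_fun [set: R] (ell_power c p).
Proof.
apply/(measurable_restrictT _ _).1 => //.
by apply: emeasurable_funM => //; exact: measurable_poweR_ell.
Qed.

Lemma ell_power_ge0 c p t : (0 <= ell_power c p t)%E.
Proof.
apply: erestrict_ge0 => {}t _; apply: mule_ge0; last exact: poweR_ge0.
by rewrite lee_fin powR_ge0.
Qed.

Lemma integral_ell_power c p :
  (\int[lebesgue_measure]_t ell_power c p t = (c `^ p)%:E *
   \int[lebesgue_measure]_(t in `[0%R, 1%R]) (ell P X t `^ p))%E.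
Proof.
rewrite -integral_mkcond ge0_integralZl_EFin ?powR_ge0//.
- by move=> t _; exact: poweR_ge0.
- exact: measurable_poweR_ell.
Qed.

Let ell_power_gt c p y t : 0 < c -> 0 < p -> 0 <= y -> `[0%R, 1%R]%classic t ->
  (y%:E < (c `^ p)%:E * ell P X t `^ p)%E = ((y `^ p^-1 / c)%:E < ell P X t)%E.
Proof.
move=> c0 p0 y0 t01.
have l0 : (0 <= ell P X t)%E.
  by apply: ell_ge0; move: t01; rewrite /= in_itv/= => /andP[].
have ce0 : (0 <= c%:E)%E by rewrite lee_fin ltW.
rewrite -poweR_EFin -poweRM// lt_poweR_root//; last exact: mule_ge0.
by rewrite muleC -lte_pdivrMr// EFinM.
Qed.

Lemma lebesgue_measure_ell_power_gt c p y : 0 < c -> 0 < p -> 0 <= y ->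
  lebesgue_measure [set t | (y%:E < ell_power c p t)%E] =
  Order.min 1%E (tail_sum (y `^ p^-1 / c)).
Proof.
move=> c0 p0 y0.
rewrite -lebesgue_measure_ell_gt; last by rewrite divr_ge0 ?powR_ge0// ltW.
congr lebesgue_measure; apply/seteqP; split => t /=.
  rewrite /ell_power patchE; case: ifPn => [|_]; last by rewrite lte_fin ltNge y0.
  by rewrite inE => t01 h; split => //; rewrite -ell_power_gt.
move=> [t01 h]; rewrite /ell_power patchE ifT; last by rewrite inE.
by rewrite ell_power_gt.
Qed.

End ell_distribution.

(* From [(1 - a) (1 + a) <= 1]; it gives [1 - prod (1 - a_i) >= s / (1 + s)] for
   [s = sum a_i]. *)
Lemma prod_oneB_sum_le (R : realFieldType) (I : Type) (r : seq I) (a : I -> R) :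
  (forall i, 0 <= a i <= 1) ->
  \prod_(i <- r) (1 - a i) * (1 + \sum_(i <- r) a i) <= 1.
Proof.
move=> a01; elim: r => [|i r IH]; first by rewrite !big_nil addr0 mulr1.
have : 0 <= \prod_(j <- r) (1 - a j).
  by apply: prodr_ge0 => j _; have := a01 j; lra.
have : 0 <= \sum_(j <- r) a j by apply: sumr_ge0 => j _; have := a01 j; lra.
rewrite !big_cons; have := a01 i; move: IH.
move: (\prod_(j <- r) _) (\sum_(j <- r) _) (a i) => b s x IH /andP[x0 x1] s0 b0.
apply: le_trans IH; rewrite -subr_ge0.
rewrite (_ : _ - _ = b * (x * (x + s))); last by ring.
by rewrite !mulr_ge0// addr_ge0.
Qed.

(** * Bounding the moment of [ell] by that of the maximum *)

Section moments.
Context {R : realType} {d : measure_display} {T : measurableType d}.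
Context {E : normedModType R} (P : probability T R).
Context {N : nat} (X : 'I_N -> T -> E).
Hypotheses (mX : forall n, random_vector (X n)) (indX : independent P X).
Implicit Types (x y p q : R).

(** If [2 * maxsum X <= x] then all [|X n| <= x]. With [s] the tail sum and [r] the probability on
    the right, independence and [prod_oneB_sum_le] give [(1 - r) * (1 + s) <= 1], that is
    [r >= s / (1 + s)], which is at least half of [min 1 s]. *)
Lemma min_tail_sum_le x : 0 <= x ->
  (Order.min 1 (tail_sum P X x) <= 2%:E * P [set w | (x < 2 * maxsum X w)%R])%E.
Proof.
move=> x0.
pose B := [set z : E | `|z| <= x].
have bB : borel B.
  rewrite -[B]setCK.
  apply: (@measurableC _ (g_sigma_algebraType [set A : set E | open A])).
  apply: sub_sigma_algebra => /=.
  rewrite (_ : ~` B = Num.norm @^-1` [set s | x < s]).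
    by apply: open_comp; [move=> z _; exact: norm_continuous|exact: open_gt].
  by apply/seteqP; split => z /=; rewrite /B/= ltNge => /negP.
have mgt n := measurable_normr_gt (X n) x%:E (mX n).
pose a n := fine (P [set w | (x%:E < `|X n w|%:E)%E]).
have aE n : P [set w | (x%:E < `|X n w|%:E)%E] = (a n)%:E.
  by rewrite fineK// fin_num_measure.
have a01 n : 0 <= a n <= 1.
  by rewrite -!lee_fin -aE measure_ge0 probability_le1.
have PB n : P (X n @^-1` B) = (1 - a n)%:E.
  rewrite EFinB -aE -probability_setC//; congr (P _).
  by apply/seteqP; split => w; rewrite /B/= lte_fin leNgt => /negP.
have sumE : tail_sum P X x = (\sum_(n < N) a n)%:E.
  by rewrite /tail_sum -sumEFin; apply: eq_bigr => n _; exact: aE.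
have mU : measurable [set w | x < 2 * maxsum X w].
  rewrite (_ : mkset _ = [set w | x / 2 < maxsum X w]).
    exact: measurable_maxsum_gt.
  by apply/seteqP; split => w /=; rewrite ltr_pdivrMr// mulrC.
have := @indX (fun=> B) (fun=> bB).
under eq_bigr do rewrite PB.
rewrite -(big_morph EFin (@EFinM R) erefl) => PE.
have : (P (~` [set w | (x < 2 * maxsum X w)%R]) <= (\prod_(n < N) (1 - a n))%:E)%E.
  rewrite -PE; apply: le_measure; rewrite ?inE; first exact: measurableC.
    apply: (cylinders_measurable X mX predT).
    by exists (fun=> B) => //; apply/seteqP; split => w /= h n; [move=> _|]; exact: h.
  move=> w /= /negP; rewrite -leNgt => Ux n; rewrite /B/=.
  by apply: le_trans Ux; exact: norm_le_maxsum.
rewrite probability_setC// sumE.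
rewrite -(fineK (fin_num_measure P _ mU)); move: (fine _) => r.
rewrite -EFinB -EFinM -EFin_min !lee_fin => rle.
have := prod_oneB_sum_le _ _ (index_enum 'I_N) a a01.
have : 0 <= \sum_(n < N) a n by apply: sumr_ge0 => n _; have := a01 n; lra.
move: rle; move: (\prod_(n < N) _) (\sum_(n < N) _) => b s rle s0 bs.
rewrite ge_min; apply/orP.
have : (1 - r) * (1 + s) <= 1 by apply: le_trans bs; rewrite ler_wpM2r// addr_ge0.
have [s1|s1] := leP s 1; [right|left]; nra.
Qed.

(** The layer-cake formula on both sides reduces this to [min_tail_sum_le] at the level [y^(1/p)].
    The factor [2^p] comes from [|X n| <= 2 * maxsum X], the other 2 from [min_tail_sum_le]. *)
Lemma integral_ell_le p : 0 < p ->
  (\int[lebesgue_measure]_(t in `[0%R, 1%R]) (ell P X t `^ p) <=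
   (2 * 2 `^ p)%:E * \int[P]_w ((maxsum X w `^ p)%:E))%E.
Proof.
move=> p0.
have mU2 : measurable_fun [set: T] (fun w => ((2 * maxsum X w) `^ p)%:E).
  apply/measurable_EFinP; apply: (measurableT_comp (measurable_powR p)).
  by apply: measurable_funM => //; exact: measurable_maxsum.
have mU1 : measurable_fun [set: T] (fun w => (maxsum X w `^ p)%:E).
  apply/measurable_EFinP; apply: (measurableT_comp (measurable_powR p)).
  exact: measurable_maxsum.
rewrite [leLHS](_ : _ = \int[lebesgue_measure]_t ell_power P X 1 p t)%E; last first.
  by rewrite integral_ell_power// powR1 mul1e.
rewrite layer_cake; [|exact: measurable_ell_power|exact: ell_power_ge0].
have -> : ((2 * 2 `^ p)%:E * \int[P]_w ((maxsum X w `^ p)%:E) =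
    2%:E * \int[P]_w (((2 * maxsum X w) `^ p)%:E))%E.
  rewrite EFinM -muleA; congr (_ * _)%E.
  rewrite -ge0_integralZl_EFin ?powR_ge0//; last by move=> w _; rewrite lee_fin powR_ge0.
  by apply: eq_integral => w _; rewrite powRM ?maxsum_ge0.
rewrite (layer_cake P _ mU2); last by move=> w; rewrite lee_fin powR_ge0.
rewrite -ge0_integralZl_EFin//; last first.
  exact: (measurable_funTS (measurable_tail P _ mU2)).
apply: ge0_le_integral => //.
- exact: (measurable_funTS (measurable_tail lebesgue_measure _ (measurable_ell_power _ _ mX _ _))).
- apply: emeasurable_funM => //.
  exact: (measurable_funTS (measurable_tail P _ mU2)).
move=> y; rewrite /= in_itv/= andbT => y0.
rewrite lebesgue_measure_ell_power_gt// divr1.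
apply: (le_trans (min_tail_sum_le _ (powR_ge0 _ _))).
rewrite [X in (_ <= _ * P X)%E](_ : _ = [set w | y `^ p^-1 < 2 * maxsum X w])//.
apply/seteqP; split => w /=; rewrite -poweR_EFin lt_poweR_root ?lte_fin//;
  by rewrite lee_fin mulr_ge0// maxsum_ge0.
Qed.

End moments.

(** * Bounding the moment of the maximum by absorption *)

Section upper_moment.
Context {R : realType} {d : measure_display} {T : measurableType d}.
Context {E : normedModType R} (P : probability T R).
Context {N : nat} (X : 'I_N -> T -> E).
Hypotheses (mX : forall n, random_vector (X n)) (indX : independent P X).
Variables (p q : R).
Hypotheses (p0 : 0 < p) (q0 : 0 <= q).
Hypothesis Uq : forall q', q < q' ->
  (P [set w | (q' < maxsum X w)%R] <= (expR (- p) / 2)%:E)%E.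

(* Truncated so that the moment absorbed in [integral_V_le] is finite. *)
Let V (K : R) (w : T) := Num.min (maxsum X w) K.

Let V_ge0 K w : 0 <= K -> 0 <= V K w.
Proof. by move=> K0; rewrite le_min maxsum_ge0. Qed.

Let measurable_V K (c : R) :
  measurable_fun [set: T] (fun w => ((c * V K w) `^ p)%:E).
Proof.
apply/measurable_EFinP; apply: (measurableT_comp (measurable_powR p)).
apply: measurable_funM => //; apply: measurable_minr => //.
exact: measurable_maxsum.
Qed.

(** Put [x = y^(1/p)]. The indicator pays for [x <= 4 * q], and the minimum with 1 in the
    distribution of [ell] pays for a tail sum of at least 1, so the bound holds at every level and
    can be integrated in [y]. *)
Let tail_V_le K y : 0 < K -> 0 <= y ->
  (P [set w | y%:E < ((2^-1 * V K w) `^ p)%:E] <=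
   (\1_(`[0%R, (4 * q) `^ p]%classic : set R) y)%:E +
   (lebesgue_measure [set t | y%:E < ell_power P X 2 p t] +
    (expR (- p) / 2)%:E * P [set w | y%:E < ((1 * V K w) `^ p)%:E]))%E.
Proof.
move=> K0 y0; have VK w := V_ge0 K w (ltW K0).
set x := y `^ p^-1; have x0 : 0 <= x by exact: powR_ge0.
have e0 : 0 <= expR (- p) / 2 by rewrite divr_ge0// expR_ge0.
have setE c : 0 < c ->
    [set w | (y%:E < ((c * V K w) `^ p)%:E)%E] = [set w | x < c * V K w].
  move=> c0; apply/seteqP; split => w /=; rewrite -poweR_EFin lt_poweR_root ?lte_fin//;
    by rewrite lee_fin mulr_ge0// ltW.
rewrite !setE ?invr_gt0// lebesgue_measure_ell_power_gt// -/x.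
have mV c : 0 < c -> measurable [set w | x < c * V K w].
  move=> c0; rewrite -setE// -[X in measurable X]setTI.
  exact: emeasurable_fun_o_infty.
have r0 : (0 <= (expR (- p) / 2)%:E * P [set w | (x < 1 * V K w)%R])%E.
  by rewrite mule_ge0// lee_fin.
have m0 : (0 <= Order.min 1 (tail_sum P X (x / 2)))%E.
  by rewrite le_min lee01 tail_sum_ge0.
have le1 : (P [set w | (x < 2^-1 * V K w)%R] <= 1)%E.
  by apply: probability_le1; apply: mV; rewrite invr_gt0.
have [xq|xq] := leP x (4 * q).
  rewrite indicE mem_set; last first.
    rewrite /= in_itv/= y0/=.
    have -> : y = x `^ p by rewrite /x -powRrM mulVf ?gt_eqF// powRr1.
    by apply: ge0_ler_powR; rewrite ?nnegrE ?mulr_ge0// ltW.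
  by apply: (le_trans le1); rewrite leeDl// adde_ge0.
apply: (@le_trans _ _ (Order.min 1 (tail_sum P X (x / 2)) +
  (expR (- p) / 2)%:E * P [set w | (x < 1 * V K w)%R])%E); last first.
  by rewrite leeDr// lee_fin.
have x1 : 0 < x by apply: le_lt_trans xq; rewrite mulr_ge0.
(* If [K <= 2 * x] the left event is empty; otherwise [x < K], and exceeding [x] means the same for
   [V K] and [maxsum X]. *)
have [Kx|Kx] := leP K (2 * x).
  rewrite [X in P X](_ : _ = set0); first by rewrite measure0 adde_ge0.
  apply/seteqP; split => w //=.
  have : V K w <= K by rewrite ge_min lexx orbT.
  by move=> ? ?; lra.
have [t1|t1] := leP 1%E (tail_sum P X (x / 2)).
  by apply: (le_trans le1); rewrite leeDl.
(* The levels [u = x], [v = x / 2], [z = x / 4] satisfy [u + v + 2 * z = 2 * x], and [z > q] makes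
   [Uq] available. *)
apply: (@le_trans _ _ (P [set w | (x + x / 2 + 2 * (x / 4) < maxsum X w)%R])).
  apply: le_measure; rewrite ?inE; [by apply: mV; rewrite invr_gt0|
    exact: measurable_maxsum_gt|].
  move=> w /=; have : V K w <= maxsum X w by rewrite ge_min lexx.
  by move=> ? ?; lra.
apply: (le_trans (hoffmann_jorgensen P X mX indX _ _ _ _ _ _)) => //;
  try by rewrite divr_ge0.
apply: leeD => //; rewrite muleC; apply: lee_pmul => //.
  by apply: Uq; lra.
apply: le_measure; rewrite ?inE; [exact: measurable_maxsum_gt|exact: mV|].
by move=> w /= xU; rewrite mul1r lt_min xU/=; lra.
Qed.

Let L := (\int[lebesgue_measure]_(t in `[0%R, 1%R]) (ell P X t `^ p))%E.

(** Integrating [tail_V_le] gives [key]. After multiplication by [2^p] the last term is at most half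
    of [I], and since [V K <= K] makes [I] finite, it can be moved to the left. *)
Let integral_V_le K : 0 < K ->
  (\int[P]_w ((V K w `^ p)%:E) <= (2 * (8 * q) `^ p)%:E + (2 * 4 `^ p)%:E * L)%E.
Proof.
move=> K0; have VK w := V_ge0 K w (ltW K0).
have L0 : (0 <= L)%E by apply: integral_ge0 => t _; exact: poweR_ge0.
have V1 : (fun w => (V K w `^ p)%:E) = (fun w => ((1 * V K w) `^ p)%:E).
  by apply/funext => w; rewrite mul1r.
set I := (\int[P]_w _)%E.
have I0 : (0 <= I)%E by apply: integral_ge0 => w _; rewrite lee_fin powR_ge0.
have Ifin : I \is a fin_num.
  rewrite ge0_fin_numE//; apply: (@le_lt_trans _ _ (\int[P]_w (K `^ p)%:E)%E).
    apply: ge0_le_integral => //; [by move=> w _; rewrite lee_fin powR_ge0| |].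
      by rewrite V1; exact: measurable_V.
    move=> w _; rewrite lee_fin ge0_ler_powR ?nnegrE//; [exact: ltW|exact: ltW|].
    by rewrite ge_min lexx orbT.
  by rewrite integral_cst// ltey_eq fin_numM// fin_num_measure.
have key : ((2^-1 `^ p)%:E * I <=
    ((4 * q) `^ p)%:E + ((2 `^ p)%:E * L + (expR (- p) / 2)%:E * I))%E.
  rewrite -integral_ell_power// (layer_cake lebesgue_measure); last 2 first.
    exact: measurable_ell_power.
    exact: ell_power_ge0.
  have -> : ((2^-1 `^ p)%:E * I = \int[P]_w (((2^-1 * V K w) `^ p)%:E))%E.
    rewrite -ge0_integralZl_EFin ?powR_ge0//.
    - by apply: eq_integral => w _; rewrite powRM.
    - by move=> w _; rewrite lee_fin powR_ge0.
    - by rewrite V1; exact: measurable_V.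
  rewrite /I V1 !(layer_cake P); try exact: measurable_V;
    try by move=> w; rewrite lee_fin powR_ge0.
  have -> : ((4 * q) `^ p)%:E = (\int[lebesgue_measure]_(y in `[0%R, +oo[)
      (\1_(`[0%R, (4 * q) `^ p]%classic : set R) y)%:E)%E.
    rewrite integral_indic// setIidl.
      rewrite -[RHS]/(lebesgue_measure (`[0%R, (4 * q) `^ p]%classic : set R)).
      rewrite lebesgue_measure_itv/= lte_fin.
      by case: ltgtP (powR_ge0 (4 * q) p) => [_|//|<-//] _; rewrite oppr0 adde0.
    by move=> y /=; rewrite !in_itv/= andbT => /andP[].
  have mtV c : measurable_fun (`[0%R, +oo[%classic : set R)
      (fun y : R => P [set w | (y%:E < ((c * V K w) `^ p)%:E)%E]).
    exact: (measurable_funTS (measurable_tail P _ (measurable_V K c))).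
  have mtl : measurable_fun (`[0%R, +oo[%classic : set R)
      (fun y : R => lebesgue_measure [set t | (y%:E < ell_power P X 2 p t)%E]).
    exact: (measurable_funTS (measurable_tail lebesgue_measure _
      (measurable_ell_power _ _ mX _ _))).
  have e0 : 0 <= expR (- p) / 2 by rewrite divr_ge0// expR_ge0.
  pose a y : \bar R := (\1_(`[0%R, (4 * q) `^ p]%classic : set R) y)%:E.
  pose b y : \bar R := lebesgue_measure [set t | (y%:E < ell_power P X 2 p t)%E].
  pose c y : \bar R := P [set w | (y%:E < ((1 * V K w) `^ p)%:E)%E].
  have ce0 y : (0 <= (expR (- p) / 2)%:E * c y)%E by rewrite mule_ge0// lee_fin.
  have mce : measurable_fun (`[0%R, +oo[%classic : set R)
      (fun y => (expR (- p) / 2)%:E * c y)%E.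
    by apply: emeasurable_funM => //; exact: mtV.
  have a0 y : (0 <= a y)%E by rewrite lee_fin.
  have b0 y : (0 <= b y)%E by exact: measure_ge0.
  have ma : measurable_fun (`[0%R, +oo[%classic : set R) a.
    by apply/measurable_EFinP; exact: measurable_indic.
  have mbc : measurable_fun (`[0%R, +oo[%classic : set R)
      (fun y => b y + (expR (- p) / 2)%:E * c y)%E by exact: emeasurable_funD.
  have bc0 y : (0 <= b y + (expR (- p) / 2)%:E * c y)%E by rewrite adde_ge0.
  have : (\int[lebesgue_measure]_(y in `[0%R, +oo[)
      P [set w | (y%:E < ((2^-1 * V K w) `^ p)%:E)] <=
      \int[lebesgue_measure]_(y in `[0%R, +oo[)
        (a y + (b y + (expR (- p) / 2)%:E * c y)))%E.
    apply: ge0_le_integral => //.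
    - exact: mtV.
    - exact: (emeasurable_funD ma mbc).
    - by move=> y; rewrite /= in_itv/= andbT => y0; exact: tail_V_le.
  rewrite ge0_integralD// ge0_integralD// ge0_integralZl_EFin//.
  exact: mtV.
have [Lfin|Linf] := boolP (L \is a fin_num); last first.
  have -> : L = +oo%E by move: Linf; rewrite ge0_fin_numE// -leNgt leye_eq => /eqP.
  by rewrite gt0_muley ?addey ?leey// lte_fin mulr_gt0// powR_gt0.
move: key; rewrite -(fineK Ifin) -(fineK Lfin) -!EFinM -!EFinD !lee_fin.
have : 0 <= fine I by exact: fine_ge0.
move: (fine I) (fine L) => i l i0 key.
(* This is [2 <= e] raised to the power [p]. *)
have e2 : 2 `^ p * expR (- p) <= 1.
  rewrite expRN ler_pdivrMr ?expR_gt0// mul1r -[in leRHS](mulr1 p) mulrC.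
  rewrite expRM; apply: ge0_ler_powR; rewrite ?nnegrE ?expR_ge0//; first exact: ltW.
  by have := expR_ge1Dx (1 : R); lra.
have p2 : 0 < (2 : R) `^ p by rewrite powR_gt0.
have h2 : 2 `^ p * 2^-1 `^ p = 1 by rewrite -powRM// divff// powR1.
have h8 : (8 * q) `^ p = 2 `^ p * (4 * q) `^ p.
  by rewrite -powRM ?mulr_ge0// mulrA; congr ((_ * q) `^ p); lra.
have h4 : 4 `^ p = 2 `^ p * 2 `^ p :> R by rewrite -powRM//; congr (_ `^ p); lra.
have := ler_wpM2l (ltW p2) key; rewrite mulrA h2 h8 h4.
have : 2 `^ p * expR (- p) * i <= i by rewrite -[leRHS]mul1r ler_wpM2r.
set A := _ `^ p; set B := _ `^ p; nra.
Qed.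

(** The bound on the truncated moments does not depend on [K], so monotone convergence along
    [K = n + 1] removes the truncation. *)
Lemma integral_maxsum_le :
  (\int[P]_w ((maxsum X w `^ p)%:E) <= (2 * (8 * q) `^ p)%:E + (2 * 4 `^ p)%:E * L)%E.
Proof.
pose g n w := (V n.+1%:R w `^ p)%:E.
have mg n : measurable_fun [set: T] (g n).
  have := measurable_V n.+1%:R 1; apply: eq_measurable_fun => w _.
  by rewrite mul1r.
(* At each [w] the sequence is constant once [n + 1] exceeds [maxsum X w]. *)
have gE w : limn (g^~ w) = (maxsum X w `^ p)%:E.
  apply: lim_near_cst => //.
  exists (Num.truncn (maxsum X w)) => // n /= Un; rewrite /g /V min_l//.
  apply: (le_trans (ltW (truncnS_gt _))); first by rewrite ler_nat.
have cg : (\int[P]_w g n w)%E @[n --> \oo] --> (\int[P]_w (maxsum X w `^ p)%:E)%E.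
  under [X in _ --> X]eq_integral do rewrite -gE.
  apply: cvg_monotone_convergence => //.
  - by move=> n w _; rewrite lee_fin powR_ge0.
  - move=> w _ m n mn; rewrite lee_fin ge0_ler_powR ?nnegrE ?V_ge0//; first exact: ltW.
    by rewrite le_min !ge_min lexx/= ler_nat ltnS mn orbT.
by apply: (cvge_to_le cg); near=> n; exact: integral_V_le.
Unshelve. all: by end_near. Qed.

End upper_moment.

(** * Comparison of norms and rearrangements *)

Section comparison.
Context {R : realType} {d : measure_display} {T : measurableType d}.
Context {E : normedModType R} (P : probability T R).
Context {N : nat} (X : 'I_N -> T -> E).
Hypotheses (mX : forall n, random_vector (X n)) (indX : independent P X).
Variables (p0 p : R).
Hypotheses (p0_gt0 : 0 < p0) (p0p : p0 <= p).

Let p_gt0 : 0 < p. Proof. exact: lt_le_trans p0p. Qed.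

Let pN0 : p != 0. Proof. by rewrite gt_eqF. Qed.

Let pV0 : 0 <= p^-1. Proof. by rewrite invr_ge0 ltW. Qed.

Let M := (\int[P]_w (maxsum X w `^ p)%:E)%E.

Let L := (\int[lebesgue_measure]_(t in `[0%R, 1%R]) (ell P X t `^ p))%E.

Let M_ge0 : (0 <= M)%E.
Proof. by apply: integral_ge0 => w _; rewrite lee_fin powR_ge0. Qed.

Let L_ge0 : (0 <= L)%E.
Proof. by apply: integral_ge0 => t _; exact: poweR_ge0. Qed.

Lemma Lnorm_maxsum :
  Lnorm P p%:E (fun w => (maxsum X w)%:E) = (M `^ p^-1)%E.
Proof.
rewrite unlock; congr (_ `^ _)%E; apply: eq_integral => w _.
by rewrite abse_EFin ger0_norm ?maxsum_ge0.
Qed.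

(** The bound [p0 <= p] enters here to make the constants uniform in [p]. *)
Let powR_root_le (c : R) : 1 <= c -> c `^ p^-1 <= c `^ p0^-1.
Proof. by move=> c1; apply: ler_powR => //; rewrite lef_pV2 ?posrE. Qed.

Let le_poweR_root (x y : \bar R) : (0 <= x)%E -> (x <= y)%E ->
  (x `^ p^-1 <= y `^ p^-1)%E.
Proof.
move=> x0 xy; apply: gt0_ler_poweR => //; rewrite in_itv/= leey andbT//.
exact: le_trans xy.
Qed.

Lemma rearr_ge0 (Y : T -> R) t : (0 <= rearr P Y t)%E.
Proof. by rewrite le_max lexx. Qed.

(** Markov's inequality for the [p]-th power of [maxsum X], followed by a [p]-th root. *)
Lemma chebyshev_maxsum (y s : R) : 0 <= y -> 0 < s ->
  (s%:E < P [set w | (y < maxsum X w)%R])%E ->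
  (y%:E <= (s^-1 `^ p^-1)%:E * M `^ p^-1)%E.
Proof.
move=> y0 s0 sP.
have mU : measurable [set w | y < maxsum X w] by exact: measurable_maxsum_gt.
have sM : ((y `^ p * s)%:E <= M)%E.
  apply: (@le_trans _ _ ((y `^ p)%:E * P [set w | (y < maxsum X w)%R])%E).
    by rewrite EFinM lee_wpmul2l ?lee_fin ?powR_ge0// ltW.
  rewrite -[X in (_ * P X)%E]setIT -integral_indic// -ge0_integralZl_EFin//.
  - apply: ge0_le_integral => //.
    + by move=> w _; rewrite mule_ge0// lee_fin powR_ge0.
    + apply: emeasurable_funM => //.
      by apply/measurable_EFinP; exact: measurable_indic.
    + apply/measurable_EFinP; apply: (measurableT_comp (measurable_powR p)).
      exact: measurable_maxsum.
    move=> w _; rewrite -EFinM lee_fin indicE.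
    have [|_] := boolP (w \in _); last by rewrite mulr0 powR_ge0.
    rewrite inE/= => yU.
    by rewrite mulr1 ge0_ler_powR ?nnegrE ?maxsum_ge0// ltW.
  - by apply/measurable_EFinP; exact: measurable_indic.
  - exact: powR_ge0.
have sV0 : 0 <= s^-1 by rewrite invr_ge0 ltW.
have ys0 : 0 <= y `^ p * s by rewrite mulr_ge0 ?powR_ge0// ltW.
have -> : y%:E = ((s^-1 `^ p^-1)%:E * ((y `^ p * s)%:E `^ p^-1))%E.
  rewrite poweR_EFin -EFinM -powRM//.
  by rewrite mulrCA mulVf ?gt_eqF// mulr1 -powRrM divff// powRr1.
apply: lee_wpmul2l; first by rewrite lee_fin powR_ge0.
by apply: le_poweR_root.
Qed.

Variable Y : T -> R.

(** [Y] will be the maximum itself or its truncated version. A level counted in the rearrangement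
    has [P(|Y| > y) > e^-p / 4], hence [P(U > y) > e^-p / 8], and Chebyshev costs
    [(8 * e^p)^(1/p) = 8^(1/p) * e]. The second summand of the constant is the root of the factor
    [2 * 2^p] in [integral_ell_le]. *)
Lemma rearr_ell_norm_le :
  (forall y, 0 <= y -> (P [set w | (y < `|Y w|)%R] <=
     P [set w | (y < maxsum X w)%R] + (expR (- p) / 8)%:E)%E) ->
  (rearr P Y (expR (- p) / 4) + ell_norm P X p <=
   (8 `^ p0^-1 * expR 1 + 2 `^ p0^-1 * 2)%:E *
   Lnorm P p%:E (fun w => (maxsum X w)%:E))%E.
Proof.
move=> YU; rewrite Lnorm_maxsum EFinD ge0_muleDl; last 2 first.
- by rewrite lee_fin mulr_ge0 ?powR_ge0// expR_ge0.
- by rewrite lee_fin mulr_ge0// powR_ge0.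
have M0 : (0 <= M `^ p^-1)%E by exact: poweR_ge0.
apply: leeD.
  rewrite /rearr ge_max; apply/andP; split.
    by rewrite mule_ge0// lee_fin mulr_ge0 ?powR_ge0// expR_ge0.
  apply: ge_ereal_sup => _ [y [y0 ay] <-].
  have e8 : 0 < expR (- p) / 8 by rewrite divr_gt0// expR_gt0.
  have {ay} : ((expR (- p) / 8)%:E < P [set w | (y < maxsum X w)%R])%E.
    have := lt_le_trans ay (YU _ y0).
    rewrite -lteBlDr// -EFinB; congr (_%:E < _)%E.
    by lra.
  move=> /(chebyshev_maxsum _ _ y0 e8) /le_trans; apply; apply: lee_wpmul2r => //.
  rewrite lee_fin invf_div -expRN opprK powRM ?expR_ge0//.
  rewrite [X in _ * X](_ : _ = expR 1); last first.
    by rewrite -[X in expR X](mul1r p) expRM -powRrM divff// powRr1 ?expR_ge0.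
  by rewrite ler_wpM2r ?expR_ge0// powR_root_le// ler1n.
rewrite /ell_norm -/L.
apply: (@le_trans _ _ (((2 * 2 `^ p)%:E * M) `^ p^-1)%E).
  by apply: le_poweR_root => //; exact: integral_ell_le.
rewrite poweRM//.
apply: lee_wpmul2r => //; rewrite poweR_EFin lee_fin powRM ?powR_ge0//.
by rewrite -powRrM divff// powRr1// ler_wpM2r// powR_root_le// ler1n.
Qed.

(** Above the rearrangement [r] of [Y] the tail of [Y] is at most [e^-p / 4], so that of [maxsum X]
    is at most [e^-p / 4 + e^-p / 8 <= e^-p / 2]; [integral_maxsum_le] therefore applies with
    [q = r]. *)
Lemma Lnorm_maxsum_le :
  (forall y, 0 <= y -> (P [set w | (y < maxsum X w)%R] <=
     P [set w | (y < `|Y w|)%R] + (expR (- p) / 8)%:E)%E) ->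
  (Lnorm P p%:E (fun w => (maxsum X w)%:E) <=
   (4 `^ p0^-1 * 8)%:E * (rearr P Y (expR (- p) / 4) + ell_norm P X p))%E.
Proof.
move=> UY; rewrite Lnorm_maxsum /ell_norm -/L.
have C0 : 0 < (4 : R) `^ p0^-1 * 8 by rewrite mulr_gt0// powR_gt0.
set r := rearr _ _ _; have r0 : (0 <= r)%E by exact: rearr_ge0.
have Lp0 : (0 <= L `^ p^-1)%E by exact: poweR_ge0.
have [rfin|] := boolP (r \is a fin_num); last first.
  rewrite ge0_fin_numE// -leNgt leye_eq => /eqP ->.
  by rewrite addye ?gt0_muley ?leey// gt_eqF// (lt_le_trans _ Lp0)// ltNy0.
have [Lfin|] := boolP (L \is a fin_num); last first.
  rewrite ge0_fin_numE// -leNgt leye_eq => /eqP ->.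
  rewrite poweRyr ?invr_eq0// addey ?gt0_muley ?leey//.
  by rewrite gt_eqF// (lt_le_trans _ r0)// ltNy0.
have q0 : 0 <= fine r by exact: fine_ge0.
have Uq q' : fine r < q' ->
    (P [set w | (q' < maxsum X w)%R] <= (expR (- p) / 2)%:E)%E.
  move=> rq'; have q'0 : 0 <= q' by exact: ltW (le_lt_trans q0 rq').
  have Yq : (P [set w | (q' < `|Y w|)%R] <= (expR (- p) / 4)%:E)%E.
    rewrite leNgt; apply/negP => h.
    have : (q'%:E <= r)%E.
      by rewrite /r /rearr le_max; apply/orP; right; apply: ereal_sup_ubound; exists q'.
    by rewrite -(fineK rfin) lee_fin leNgt rq'.
  apply: (le_trans (UY _ q'0)); apply: (le_trans (leeD2r _ Yq)).
  by rewrite -EFinD lee_fin; have := expR_gt0 (- p); lra.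
have := integral_maxsum_le P X mX indX p (fine r) p_gt0 q0 Uq; rewrite -/M -/L.
move=> /(le_poweR_root _ _ M_ge0) /le_trans; apply.
rewrite -[in leRHS](fineK rfin) -(fineK Lfin) -!EFinM -EFinD poweR_EFin lee_fin.
have l0 : 0 <= fine L by exact: fine_ge0.
move: (fine r) q0 (fine L) l0 => {Uq rfin Lfin} q q0 l l0.
set m := l `^ p^-1; have m0 : 0 <= m by exact: powR_ge0.
have lE : l = m `^ p by rewrite /m -powRrM mulVf// powRr1.
have p_ge0 := ltW p_gt0.
have le1 : (8 * q) `^ p <= (8 * (q + m)) `^ p.
  by apply: ge0_ler_powR; rewrite ?nnegrE ?mulr_ge0 ?addr_ge0//; lra.
have le2 : 4 `^ p * l <= (8 * (q + m)) `^ p.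
  rewrite lE -powRM//.
  by apply: ge0_ler_powR; rewrite ?nnegrE ?mulr_ge0 ?addr_ge0//; lra.
(* Both terms of the moment bound are at most [2 * (8 * (q + m))^p], where [m] is the [p]-norm of
   [ell]. *)
apply: (@le_trans _ _ ((4 * (8 * (q + m)) `^ p) `^ p^-1)).
  apply: ge0_ler_powR => //; rewrite ?nnegrE.
  - by rewrite addr_ge0// !mulr_ge0 ?powR_ge0.
  - by rewrite mulr_ge0 ?powR_ge0.
  - by move: le1 le2; rewrite -mulrA; lra.
rewrite powRM ?powR_ge0// -powRrM divff// powRr1 ?mulr_ge0 ?addr_ge0//.
by rewrite -mulrA ler_wpM2r ?mulr_ge0 ?addr_ge0// powR_root_le// ler1n.
Qed.

End comparison.

(** * Effect of truncation on the maximum *)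

Section truncation.
Context {R : realType} {d : measure_display} {T : measurableType d}.
Context {E : normedModType R} (P : probability T R).
Context {N : nat} (X : 'I_N -> T -> E).
Hypothesis mX : forall n, random_vector (X n).
Variable t : R.
Hypothesis t01 : 0 <= t <= 1.

Let Us := maxsum (fun n => trunc_le (ell P X t) (X n)).

Let cut := \big[setU/set0]_(n < N) [set w | (ell P X t < `|X n w|%:E)%E].

Let measurable_cut : measurable cut.
Proof. by apply: bigsetU_measurable => n _; exact: measurable_normr_gt. Qed.

(** Since [t <= 1], [ell] agrees with [elltilde] at [t]; its infimum is attained, so the union bound
    gives [t]. *)
Let cut_le : (P cut <= t%:E)%E.
Proof.
have /andP[t0 t1] := t01; have [_ tail_le _] := elltilde_least P mX t0.
rewrite /cut /ell t1; apply: le_trans tail_le; apply: measure_bigsetU_le => n.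
exact: measurable_normr_gt.
Qed.

Let maxsum_truncE w : ~ cut w -> Us w = maxsum X w.
Proof.
move=> Ncut; have truncE n : trunc_le (ell P X t) (X n) w = X n w.
  rewrite /trunc_le ifT// leNgt; apply/negP => h; apply: Ncut.
  by apply/bigsetU_finP; exists n.
rewrite /Us /maxsum; apply: eq_bigr => n _; congr `|_|.
by apply: eq_bigr => k _; exact: truncE.
Qed.

Let mUs y : measurable [set w | y < Us w].
Proof.
by apply: measurable_maxsum_gt => n; exact: random_vector_trunc_le.
Qed.

Let mU y : measurable [set w | y < maxsum X w].
Proof. exact: measurable_maxsum_gt. Qed.

Let le_prob_cut (A B : set T) : measurable A -> measurable B ->
  A `<=` B `|` cut -> (P A <= P B + t%:E)%E.
Proof.
move=> mA mB AB; apply: (@le_trans _ _ (P (B `|` cut))).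
  by apply: le_measure; rewrite ?inE//; exact: measurableU.
by apply: (le_trans (measureU2 _ mB measurable_cut)); exact: leeD2l.
Qed.

(** Off [cut] no summand is changed, so both maxima agree there; the same argument gives the reverse
    comparison. *)
Lemma prob_maxsum_le_trunc y :
  (P [set w | (y < maxsum X w)%R] <= P [set w | (y < Us w)%R] + t%:E)%E.
Proof.
apply: le_prob_cut => // w /= yU.
have [|/maxsum_truncE UE] := pselect (cut w); first by right.
by left; rewrite UE.
Qed.

Lemma prob_trunc_le_maxsum y :
  (P [set w | (y < Us w)%R] <= P [set w | (y < maxsum X w)%R] + t%:E)%E.
Proof.
apply: le_prob_cut => // w /= yU.
have [|/maxsum_truncE UE] := pselect (cut w); first by right.
by left; rewrite -UE.
Qed.

End truncation.

(** * Combining the bounds *)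

Theorem theorem6p1 (R : realType) (p0 : R) (hp0 : 0 < p0) :
  exists C : R, 1 <= C /\
    forall (d : measure_display) (T : measurableType d) (P : probability T R)
      (E : completeNormedModType R) (N : nat) (X : 'I_N -> T -> E) (p : R),
      (0 < N)%N ->
      (forall n, random_vector (X n)) ->
      independent P X ->
      p0 <= p ->
      let U := maxsum X in
      let s := ell P X (expR (- p) / 8) in
      let Us := maxsum (fun n => trunc_le s (X n)) in
      let A1 := Lnorm P p%:E (fun w => (U w)%:E) in
      let A2 := (rearr P U (expR (- p) / 4) + ell_norm P X p)%E in
      let A3 := (rearr P Us (expR (- p) / 4) + ell_norm P X p)%E in
      [/\ within_factor C A1 A2, within_factor C A2 A3 & within_factor C A1 A3].
Proof.
(* [C1] bounds the norm of the maximum by either of the other quantities, and [C2] bounds these by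
   the norm. *)
pose C1 : R := 4 `^ p0^-1 * 8.
pose C2 : R := 8 `^ p0^-1 * expR 1 + 2 `^ p0^-1 * 2.
have root1 (c : R) : 1 <= c -> 1 <= c `^ p0^-1.
  by move=> c1; rewrite -[leLHS](powRr0 c); apply: ler_powR => //; rewrite invr_ge0 ltW.
have C1_ge1 : 1 <= C1 by rewrite /C1; have := root1 4; lra.
have C2_ge1 : 1 <= C2.
  rewrite /C2; have := root1 2; have := mulr_ge0 (powR_ge0 8 p0^-1) (expR_ge0 (1 : R)).
  by lra.
exists (C1 * C2); split; first by rewrite mulr_ege1.
move=> d T P E N X p N0 mX indX p0p U s Us A1 A2 A3.
have p_gt0 : 0 < p by exact: lt_le_trans p0p.
have t01 : 0 <= expR (- p) / 8 <= 1.
  rewrite divr_ge0 ?expR_ge0//=; have : expR (- p) <= 1 by rewrite -expR0 ler_expR; lra.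
  by lra.
have normU (Z : 'I_N -> T -> E) y :
    [set w | y < `|maxsum Z w|] = [set w | y < maxsum Z w].
  by apply/seteqP; split => w /=; rewrite ger0_norm ?maxsum_ge0.
have e0 : (0 <= (expR (- p) / 8)%:E)%E by rewrite lee_fin; have /andP[] := t01.
have A12 : (A1 <= C1%:E * A2)%E.
  apply: (Lnorm_maxsum_le P X mX indX) => // y _.
  by rewrite normU leeDl.
have A21 : (A2 <= C2%:E * A1)%E.
  apply: (rearr_ell_norm_le P X mX indX) => // y _.
  by rewrite normU leeDl.
have A13 : (A1 <= C1%:E * A3)%E.
  apply: (Lnorm_maxsum_le P X mX indX) => // y _.
  by rewrite normU; exact: prob_maxsum_le_trunc.
have A31 : (A3 <= C2%:E * A1)%E.
  apply: (rearr_ell_norm_le P X mX indX) => // y _.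
  by rewrite normU; exact: prob_trunc_le_maxsum.
have A1_ge0 : (0 <= A1)%E by exact: Lnorm_ge0.
have ell0 : (0 <= ell_norm P X p)%E by exact: poweR_ge0.
have A2_ge0 : (0 <= A2)%E by rewrite adde_ge0// rearr_ge0.
have A3_ge0 : (0 <= A3)%E by rewrite adde_ge0// rearr_ge0.
have C1_ge0 : 0 <= C1 by lra.
have C2_ge0 : 0 <= C2 by lra.
have C1C B : (0 <= B -> C1%:E * B <= (C1 * C2)%:E * B)%E.
  by move=> B0; apply: lee_wpmul2r => //; rewrite lee_fin ler_peMr.
have C2C B : (0 <= B -> C2%:E * B <= (C1 * C2)%:E * B)%E.
  by move=> B0; apply: lee_wpmul2r => //; rewrite lee_fin ler_peMl.
(* The second and third quantities are compared through the first, which is why the final constant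
   is a product. *)
have chain (A B D : \bar R) : (A <= C2%:E * B -> B <= C1%:E * D ->
    A <= (C1 * C2)%:E * D)%E.
  move=> AB BD; apply: (le_trans AB); rewrite mulrC EFinM -muleA.
  by apply: lee_wpmul2l => //; rewrite lee_fin.
split; split.
- exact: le_trans A12 (C1C _ A2_ge0).
- exact: le_trans A21 (C2C _ A1_ge0).
- exact: chain A21 A13.
- exact: chain A31 A12.
- exact: le_trans A13 (C1C _ A3_ge0).
- exact: le_trans A31 (C2C _ A1_ge0).
Qed.
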